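(* Let $\alpha \leq \kappa(\mathfrak{Small})$ be a regular cardinal that is also a strong limit cardinal, and let $\mathfrak{J}_\alpha$ be a set of $\alpha$-small sets containing all $\alpha$-small cardinals. Let $(\Sigma,A)$ be a $\mathfrak{J}_\alpha$-ary algebra whose underlying set $A$ is $\alpha$-small. Then the $\mathfrak{J}_\alpha$-ary double centralizer $(\Sigma^A)^{\perp\perp}$ is the set of all $\mathfrak{J}_\alpha$-ary operations $f:A^J \rightarrow A$ such that $h(f) = f(h \circ u_J)$ for every $\Sigma$-homomorphism $h:A^{(A^J)} \rightarrow A$, where $u_J:J\to A^{(A^J)}$ is the map that sends each $j\in J$ to the projection $\pi_j:A^J\to A$.
   Context: Fix a Grothendieck universe $\mathfrak{Small}$, i.e. the set of all sets of rank less than a fixed inaccessible cardinal $\kappa = \kappa(\mathfrak{Small})$; its elements are called small sets. Let $\alpha \leq \kappa(\mathfrak{Small})$ be an (infinite) regular cardinal. It is a strong limit cardinal if $2^\beta<\alpha$ for every cardinal $\beta<\alpha$. A set is $\alpha$-small if it is small and has cardinality less than $\alpha$. Fix a set $\mathfrak{J}_\alpha$ of sets with $\mathfrak{Card}_\alpha \subseteq \mathfrak{J}_\alpha \subseteq \mathfrak{Small}_\alpha$, where $\mathfrak{Card}_\alpha$ is the set of all $\alpha$-small cardinals and $\mathfrak{Small}_\alpha$ is the set of all $\alpha$-small sets. Given a set $A$, a $\mathfrak{J}_\alpha$-ary operation on $A$ is a map $A^J \to A$ with $J \in \mathfrak{J}_\alpha$ (its arity); nullary operations are allowed. A $\mathfrak{J}_\alpha$-ary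 signature is a (possibly large) set $\Sigma$ with an assignment of an arity in $\mathfrak{J}_\alpha$ to each $\sigma\in\Sigma$. A $\Sigma$-algebra is a set $A$ equipped with an operation $\sigma^A:A^J\to A$ for each $\sigma\in\Sigma$, where $J$ is the arity of $\sigma$; a $\Sigma$-homomorphism is a map preserving these basic operations. A $\mathfrak{J}_\alpha$-ary algebra is a pair $(\Sigma,A)$ of a $\mathfrak{J}_\alpha$-ary signature $\Sigma$ and a $\Sigma$-algebra $A$; write $\Sigma^A=\{\sigma^A\mid\sigma\in\Sigma\}$. Each power $A^Y$ is a $\Sigma$-algebra under the pointwise operations; in particular $A^{(A^J)}$ is a $\Sigma$-algebra. Operations $f:A^X\to A$ and $g:A^Y\to A$ commute, written $f\perp g$, if for every matrix $a=(a_{xy})\in A^{X\times Y}$ one has $g\bigl((f((a_{xy})_{x\in X}))_{y\in Y}\bigr)=f\bigl((g((a_{xy})_{y\in Y}))_{x\in X}\bigr)$. For a set $G$ of $\mathfrak{J}_\alpha$-ary operations on $A$, $G^\perp$ is the set of all $\mathfrak{J}_\alpha$-ary operations $f$ on $A$ with $f\perp g$ for all $g\in G$, and $G^{\perp\perp}=(G^\perp)^\perp$ is its $\mathfrak{J}_\alpha$-ary double centralizer. In $h(f)$, the map $f:A^J\to A$ is regarded as an element of $A^{(A^J)}$; and $h\circ u_J:J\to A$ is regarded as an element of $A^J$. *)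

(* Defs.v *)
From mathcomp Require Import all_boot.
From mathcomp Require Import boolp classical_sets functions cardinality.

Set Implicit Arguments.
Unset Strict Implicit.
Unset Printing Implicit Defensive.

Local Open Scope classical_set_scope.
Local Open Scope card_scope.

(* Sets are modelled by types, and a set of sets by a term of type [set Type].
   A cardinal number is likewise a type, compared with others by [#<=]. *)

Definition card_lt (T U : Type) (A : set T) (B : set U) : Prop :=
  A #<= B /\ ~ (B #<= A).

(* The analogue of the class of initial ordinals: exactly one representative of
   each equipotence class.  The representatives themselves are left arbitrary. *)
Definition cardinal_system (Card : set Type) : Prop :=
  forall X : Type, exists! C : Type, Card C /\ [set: C] #= [set: X].

Definition regular_cardinal (alpha : Type) : Prop :=
  infinite_set [set: alpha] /\
  forall (I T : Type) (F : I -> set T),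
    card_lt [set: I] [set: alpha] ->
    (forall i, card_lt (F i) [set: alpha]) ->
    card_lt (\bigcup_i F i) [set: alpha].

Definition strong_limit_cardinal (alpha : Type) : Prop :=
  forall B : Type, card_lt [set: B] [set: alpha] ->
    card_lt [set: B -> bool] [set: alpha].

Definition inaccessible_cardinal (kappa : Type) : Prop :=
  [/\ ~ countable [set: kappa], regular_cardinal kappa
    & strong_limit_cardinal kappa].

(* Up to bijection, the sets of rank less than an inaccessible [kappa] are the
   sets of cardinality less than [kappa]. *)
Definition Small (kappa : Type) : set Type :=
  [set X : Type | card_lt [set: X] [set: kappa]].

Definition Small_below (kappa alpha : Type) : set Type :=
  [set X : Type | Small kappa X /\ card_lt [set: X] [set: alpha]].

Definition Card_below (Card : set Type) (kappa alpha : Type) : set Type :=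
  [set C : Type | Card C /\ Small_below kappa alpha C].

Record operation (J : set Type) (A : Type) : Type := Operation {
  arity : Type;
  arityP : J arity;
  op_fun :> (arity -> A) -> A
}.
Arguments op_fun {J A} _ _.

Record signature (J : set Type) : Type := Signature {
  symbol : Type;
  symbol_arity : symbol -> Type;
  symbol_arityP : forall s : symbol, J (symbol_arity s)
}.

Record algebra (J : set Type) (S : signature J) : Type := Algebra {
  carrier :> Type;
  interp : forall s : symbol S, (symbol_arity s -> carrier) -> carrier
}.

Definition homomorphism (J : set Type) (S : signature J) (A B : algebra S)
    (h : A -> B) : Prop :=
  forall (s : symbol S) (a : symbol_arity s -> A),
    h (interp a) = interp (fun x => h (a x)).

Definition power_algebra (J : set Type) (S : signature J) (A : algebra S)
    (Y : Type) : algebra S :=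
  @Algebra J S (Y -> A)
    (fun (s : symbol S) (a : symbol_arity s -> Y -> A) (y : Y) =>
       interp (fun x => a x y)).

Definition basic_operations (J : set Type) (S : signature J) (A : algebra S) :
    set (operation J A) :=
  [set Operation (symbol_arityP s) (@interp J S A s) | s in [set: symbol S]].
Arguments basic_operations {J S} A _.

Definition commute (A X Y : Type) (f : (X -> A) -> A) (g : (Y -> A) -> A) :
    Prop :=
  forall a : X * Y -> A,
    g (fun y => f (fun x => a (x, y))) = f (fun x => g (fun y => a (x, y))).

Definition centralizer (J : set Type) (A : Type) (G : set (operation J A)) :
    set (operation J A) :=
  [set f : operation J A | forall g : operation J A, G g -> commute f g].
Arguments centralizer {J A} G _.

Definition double_centralizer (J : set Type) (A : Type)
    (G : set (operation J A)) : set (operation J A) :=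
  centralizer (centralizer G).
Arguments double_centralizer {J A} G _.

Definition projections (J A : Type) : J -> (J -> A) -> A := fun j k => k j.

(* Main.v *)
Require Import Defs.
From mathcomp Require Import all_boot.
From mathcomp Require Import boolp classical_sets functions cardinality.

Local Open Scope classical_set_scope.
Local Open Scope card_scope.

(** If [g : A^K -> A] centralizes the basic operations, then for every matrix
    [a] the map sending [p] to [g] of the family [p (a _ k)] is a homomorphism
    [A^(A^J) -> A], and the displayed identity for it is exactly [f _|_ g] at
    [a].  Conversely a homomorphism [h : A^(A^J) -> A] is itself an operation in
    the centralizer, and [f _|_ h] at the evaluation matrix gives the identity
    for [h].  The index set [A^J] need not be an admissible arity, but it is
    [alpha]-small because [alpha] is a regular strong limit, so it may be
    replaced by its cardinal. *)

Lemma inj_card_leT {T U : Type} (f : T -> U) :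
  injective f -> [set: T] #<= [set: U].
Proof.
move=> f_inj; have /card_eqPle[_ le_im] := inj_card_eq (in2W f_inj) (A := setT).
by apply: card_le_trans le_im _; exact: subset_card_le.
Qed.

Lemma card_le_lt_trans {T U V : Type} {A : set T} {B : set U} {C : set V} :
  A #<= B -> card_lt B C -> card_lt A C.
Proof.
move=> leAB [leBC nleCB]; split; first exact: card_le_trans leAB leBC.
by move=> leCA; apply: nleCB; exact: card_le_trans leCA leAB.
Qed.

Lemma card_lt_le_trans {T U V : Type} {A : set T} {B : set U} {C : set V} :
  card_lt A B -> B #<= C -> card_lt A C.
Proof.
move=> [leAB nleBA] leBC; split; first exact: card_le_trans leAB leBC.
by move=> leCA; apply: nleBA; exact: card_le_trans leBC leCA.
Qed.

(** The product is a union, indexed by [X], of fibres that are images of [Y], so regularity bounds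
    it. *)
Lemma regular_prod {alpha X Y : Type} :
  regular_cardinal alpha ->
  card_lt [set: X] [set: alpha] -> card_lt [set: Y] [set: alpha] ->
  card_lt [set: X * Y] [set: alpha].
Proof.
move=> [_ regular] ltX ltY.
have -> : [set: X * Y] = \bigcup_x (pair x @` [set: Y]).
  by apply/seteqP; split=> [[x y] _ | //]; exists x => //; exists y.
apply: regular => // x.
exact: card_le_lt_trans (card_image_le _ _) ltY.
Qed.

(** A map is determined by its graph, so [X -> Y] embeds into the power set of [X * Y]. *)
Lemma strong_limit_exp {alpha X Y : Type} :
  regular_cardinal alpha -> strong_limit_cardinal alpha ->
  card_lt [set: X] [set: alpha] -> card_lt [set: Y] [set: alpha] ->
  card_lt [set: X -> Y] [set: alpha].
Proof.
move=> regular limit ltX ltY.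
apply: (card_le_lt_trans _ (limit _ (regular_prod regular ltX ltY))).
pose graph (k : X -> Y) (p : X * Y) := `[< k p.1 = p.2 >].
apply: (inj_card_leT graph) => k l eq_kl; apply/funext => x.
have /asboolP -> // : graph l (x, k x).
by rewrite -eq_kl; apply/asboolP.
Qed.

(** Equipotence yields a bijection between the subtypes of the full sets; wrapping and unwrapping
    elements carries it to the types themselves. *)
Lemma card_eqT_bij {T U : Type} : [set: T] #= [set: U] ->
  exists (e : T -> U) (e' : U -> T), cancel e e' /\ cancel e' e.
Proof.
move=> /card_bijP[f [f' fK f'K]].
exists (fun x => val (f (SigSub (mem_set (A := [set: T]) (u := x) I)))).
exists (fun y => val (f' (SigSub (mem_set (A := [set: U]) (u := y) I)))).
split=> z.
- rewrite (_ : SigSub _ = f (SigSub (mem_set (A := [set: T]) (u := z) I))).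
    by rewrite fK.
  exact: val_inj.
- rewrite (_ : SigSub _ = f' (SigSub (mem_set (A := [set: U]) (u := z) I))).
    by rewrite f'K.
  exact: val_inj.
Qed.

Lemma commute_sym {A X Y : Type} {f : (X -> A) -> A} {g : (Y -> A) -> A} :
  Defs.commute f g -> Defs.commute g f.
Proof. by move=> fg a; have := fg (fun p => a (p.2, p.1)). Qed.

(** Commuting with [interp s] is, after currying the matrix, preservation of [s]. *)
Lemma centralizer_basicP {J : set Type} {S : signature J} {A : algebra S}
    (g : operation J A) :
  centralizer (basic_operations A) g <->
  homomorphism (A := power_algebra A (arity g)) (B := A) g.
Proof.
split=> [cg s a | hom_g _ [s _ <-]].
- have /cg/commute_sym : basic_operations A
    (Operation (symbol_arityP s) (@interp J S A s)) by exists s.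
  by move=> /(_ (fun p => a p.1 p.2)).
- by apply: commute_sym => a; exact: (hom_g s (fun x y => a (x, y))).
Qed.

Theorem theorem6p2
  (Card : set Type) (CardP : cardinal_system Card)
  (kappa : Type) (kappa_card : Card kappa)
  (kappa_inaccessible : inaccessible_cardinal kappa)
  (alpha : Type) (alpha_card : Card alpha)
  (alpha_le_kappa : [set: alpha] #<= [set: kappa])
  (alpha_regular : regular_cardinal alpha)
  (alpha_strong_limit : strong_limit_cardinal alpha)
  (J : set Type)
  (Card_sub_J : Card_below Card kappa alpha `<=` J)
  (J_sub_Small : J `<=` Small_below kappa alpha)
  (S : signature J) (A : algebra S)
  (A_small : Small_below kappa alpha A) :
  double_centralizer (basic_operations A) =
  [set f : operation J A |
    forall h : power_algebra A (arity f -> A) -> A,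
      homomorphism h ->
      h (op_fun f) = f (fun j => h (projections j))].
Proof.
apply/seteqP; split=> [f ff h hom_h | f ff g /centralizer_basicP hom_g a].
- have [C [[C_card C_eq] _]] := CardP (arity f -> A).
  have C_lt : card_lt [set: C] [set: alpha].
    have [_ lt_f] := J_sub_Small _ (arityP f).
    move: C_eq; rewrite card_eq_le => /andP[leC _].
    apply: card_le_lt_trans leC _.
    exact: strong_limit_exp alpha_regular alpha_strong_limit lt_f A_small.2.
  have JC : J C.
    apply: Card_sub_J; split=> //; split=> //.
    exact: card_lt_le_trans C_lt alpha_le_kappa.
  have [e [e' [eK e'K]]] := card_eqT_bij C_eq.
  pose g := @Operation J A C JC (fun p => h (fun k => p (e' k))).
  (* Entry [(j, c)] is the value at [j] of the tuple coded by [c]: applying [f] over [j] gives [f]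
     itself, and fixing [j] gives the projection at [j]. *)
  have /ff/(_ (fun p => e p.2 p.1)) /= : centralizer (basic_operations A) g.
    apply/centralizer_basicP => s a.
    exact: (hom_h s (fun x k => a x (e' k))).
  have -> : (fun k => f (fun j => e (e' k) j)) = op_fun f.
    by apply/funext => k; rewrite e'K.
  move=> ->; congr (op_fun f _); apply/funext => j; congr h.
  by apply/funext => k; rewrite e'K.
(* Here [h] is [g] after restriction along [y |-> a (_, y)]; its values at [f] and at the
   projections unfold to the two sides of the commutation law. *)
- pose h (p : power_algebra A (arity f -> A)) : A :=
    g (fun y => p (fun x => a (x, y))).
  apply: (ff h) => s b.
  exact: (hom_g s (fun x y => b x (fun z => a (z, y)))).
Qed.
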